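(* Let $\{\mathbf{w}^k\}$ and $\{\widetilde{\mathbf{w}}^k\}$ be the sequences generated by GS-ADMM, and for $t\ge1$ put $\mathbf{w}_t=\frac1t\sum_{k=1}^t\widetilde{\mathbf{w}}^k$ and $\mathbf{u}_t=\frac1t\sum_{k=1}^t\widetilde{\mathbf{u}}^k$. Then, for any $\sigma_1\in(p-1,+\infty)$, $\sigma_2\in(q-1,+\infty)$ and $(\tau,s)\in\mathcal{K}$, where $$\mathcal{K}=\{(\tau,s)\in\mathbb{R}^2 : \tau+s>0,\ \tau\le 1,\ -\tau^2-s^2-\tau s+\tau+s+1>0\},$$ there exist constants $\xi_3,\xi_4\ge0$ such that for all integers $t\ge1$ and all $\mathbf{w}=(\mathbf{u};\lambda)\in\mathcal{M}$, $$h(\mathbf{u}_t)-h(\mathbf{u})+\langle\mathbf{w}_t-\mathbf{w},\mathcal{J}(\mathbf{w})\rangle\le\frac{1}{2t}\Big(\|\mathbf{w}-\mathbf{w}^1\|_H^2+\xi_3\|\mathcal{A}\mathbf{x}^1+\mathcal{B}\mathbf{y}^1-c\|^2+\xi_4\|\mathbf{y}^1-\mathbf{y}^0\|_{H_{\mathbf{y}}}^2\Big).$$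
   Context: Setting. $p,q\ge1$ are integers; $f_i:\mathbb{R}^{m_i}\to\mathbb{R}$ ($1\le i\le p$) and $g_j:\mathbb{R}^{d_j}\to\mathbb{R}$ ($1\le j\le q$) are closed proper convex functions; $A_i\in\mathbb{R}^{n\times m_i}$, $B_j\in\mathbb{R}^{n\times d_j}$ all have full column rank; $c\in\mathbb{R}^n$; $\mathcal{X}_i\subset\mathbb{R}^{m_i}$, $\mathcal{Y}_j\subset\mathbb{R}^{d_j}$ are closed convex sets. The problem is: minimize $\sum_i f_i(x_i)+\sum_j g_j(y_j)$ subject to $\sum_i A_ix_i+\sum_j B_jy_j=c$, $x_i\in\mathcal{X}_i$, $y_j\in\mathcal{Y}_j$; its solution set is assumed nonempty. Notation. $\mathcal{A}=(A_1,\dots,A_p)$, $\mathcal{B}=(B_1,\dots,B_q)$, $\mathbf{x}=(x_1;\dots;x_p)$, $\mathbf{y}=(y_1;\dots;y_q)$, $\mathcal{X}=\prod_i\mathcal{X}_i$, $\mathcal{Y}=\prod_j\mathcal{Y}_j$, $\mathcal{M}=\mathcal{X}\times\mathcal{Y}\times\mathbb{R}^n$, $\mathbf{u}=(\mathbf{x};\mathbf{y})$, $\mathbf{w}=(\mathbf{x};\mathbf{y};\lambda)$, $h(\mathbf{u})=\sum_{i=1}^pf_i(x_i)+\sum_{j=1}^qg_j(y_j)$, $\mathcal{J}(\mathbf{w})=(-\mathcal{A}^{\sf T}\lambda;\,-\mathcal{B}^{\sf T}\lambda;\,\mathcal{A}\mathbf{x}+\mathcal{B}\mathbf{y}-c)$.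 For $\beta>0$, $\mathcal{L}_\beta(\mathbf{x},\mathbf{y},\lambda)=h(\mathbf{u})-\langle\lambda,\mathcal{A}\mathbf{x}+\mathcal{B}\mathbf{y}-c\rangle+\frac{\beta}{2}\|\mathcal{A}\mathbf{x}+\mathcal{B}\mathbf{y}-c\|^2$. For a symmetric matrix $S$, $\|v\|_S^2=v^{\sf T}Sv$. GS-ADMM (parameters $\beta>0,\sigma_1,\sigma_2,\tau,s$). From an initial $\mathbf{w}^0=(\mathbf{x}^0;\mathbf{y}^0;\lambda^0)\in\mathcal{M}$, for $k=0,1,2,\dots$: (1) for each $i$, $x_i^{k+1}=\arg\min_{x_i\in\mathcal{X}_i}\mathcal{L}_\beta(x_1^k,\dots,x_i,\dots,x_p^k,\mathbf{y}^k,\lambda^k)+\frac{\sigma_1\beta}{2}\|A_i(x_i-x_i^k)\|^2$; (2) $\lambda^{k+\frac12}=\lambda^k-\tau\beta(\mathcal{A}\mathbf{x}^{k+1}+\mathcal{B}\mathbf{y}^k-c)$; (3) for each $j$, $y_j^{k+1}=\arg\min_{y_j\in\mathcal{Y}_j}\mathcal{L}_\beta(\mathbf{x}^{k+1},y_1^k,\dots,y_j,\dots,y_q^k,\lambda^{k+\frac12})+\frac{\sigma_2\beta}{2}\|B_j(y_j-y_j^k)\|^2$; (4) $\lambda^{k+1}=\lambda^{k+\frac12}-s\beta(\mathcal{A}\mathbf{x}^{k+1}+\mathcal{B}\mathbf{y}^{k+1}-c)$. Here $\mathbf{w}^k=(\mathbf{x}^k;\mathbf{y}^k;\lambda^k)$,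 $\widetilde{\mathbf{u}}^k=(\mathbf{x}^{k+1};\mathbf{y}^{k+1})$, and $\widetilde{\mathbf{w}}^k=(\mathbf{x}^{k+1};\mathbf{y}^{k+1};\widetilde\lambda^k)$ with $\widetilde\lambda^k=\lambda^k-\beta(\mathcal{A}\mathbf{x}^{k+1}+\mathcal{B}\mathbf{y}^k-c)$. Matrices. Let $D_A$ be the block diagonal matrix with diagonal blocks $A_i^{\sf T}A_i$ and $D_B$ the block diagonal matrix with diagonal blocks $B_j^{\sf T}B_j$. Then $H_{\mathbf{x}}=\beta[(\sigma_1+1)D_A-\mathcal{A}^{\sf T}\mathcal{A}]$ (diagonal blocks $\beta\sigma_1A_i^{\sf T}A_i$, off-diagonal blocks $-\beta A_i^{\sf T}A_l$), $H_{\mathbf{y}}=\beta[(\sigma_2+1)D_B-\mathcal{B}^{\sf T}\mathcal{B}]$, and $$H=\begin{pmatrix}H_{\mathbf{x}}&0&0\\0&\beta[(\sigma_2+1)D_B-\frac{\tau s}{\tau+s}\mathcal{B}^{\sf T}\mathcal{B}]&-\frac{\tau}{\tau+s}\mathcal{B}^{\sf T}\\0&-\frac{\tau}{\tau+s}\mathcal{B}&\frac{1}{\beta(\tau+s)}I\end{pmatrix}.$$ *)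

(* Defs.v *)
From HB Require Import structures.
From mathcomp Require Import all_boot all_order all_algebra.
From mathcomp Require Import all_classical all_reals all_analysis.

Set Implicit Arguments.
Unset Strict Implicit.
Unset Printing Implicit Defensive.

Import Order.TTheory GRing.Theory Num.Theory.
Import numFieldNormedType.Exports.

Local Open Scope classical_set_scope.
Local Open Scope ring_scope.

(* The library norm on matrices is the sup norm, so the Euclidean inner product
   and squared norms are introduced here. *)
Definition dotv (R : realType) (k : nat) (u v : 'cV[R]_k) : R := (u^T *m v) 0 0.

Definition sqnorm (R : realType) (k : nat) (u : 'cV[R]_k) : R := dotv u u.

Definition sqnorm_mx (R : realType) (k : nat) (S : 'M[R]_k) (v : 'cV[R]_k) : R :=
  (v^T *m S *m v) 0 0.

Definition is_argmin (R : realType) (T : Type) (S : set T) (F : T -> R) (z : T) :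
  Prop := S z /\ forall z', S z' -> F z <= F z'.

(* Properness is automatic because f is real valued everywhere; closedness of a
   proper convex function is lower semicontinuity. *)
Definition closed_convex_fun (R : realType) (k : nat) (f : 'cV[R]_k -> R) : Prop :=
  convex_function setT f /\ lower_semicontinuous (EFin \o f).

(* Replaces the i-th block of the stacked vector x by z. *)
Definition set_block (R : realType) (p : nat) (m : 'I_p -> nat)
    (x : 'cV[R]_(\sum_i m i)) (i : 'I_p) (z : 'cV[R]_(m i)) :
    'cV[R]_(\sum_i m i) :=
  \mxcol_j dfwith (fun l => submxcol x l) i z j.
Arguments set_block {R p m} x i z.

Record problem (R : realType) (p q n : nat) (m : 'I_p -> nat) (d : 'I_q -> nat) :=
  Problem {
    ff : forall i, 'cV[R]_(m i) -> R ;
    gg : forall j, 'cV[R]_(d j) -> R ;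
    AA : forall i, 'M[R]_(n, m i) ;
    BB : forall j, 'M[R]_(n, d j) ;
    cc : 'cV[R]_n ;
    XX : forall i, set 'cV[R]_(m i) ;
    YY : forall j, set 'cV[R]_(d j)
  }.

Arguments ff {R p q n m d} _ i _.
Arguments gg {R p q n m d} _ j _.
Arguments XX {R p q n m d} _ i _.
Arguments YY {R p q n m d} _ j _.

Section GSADMM.
Context (R : realType) (p q n : nat) (m : 'I_p -> nat) (d : 'I_q -> nat).
Context (P : problem R n m d).

Local Notation M := (\sum_i m i)%N.
Local Notation D := (\sum_j d j)%N.

(* A point w = (x; y; lambda) is one stacked column vector, blocks in this order. *)
Definition xof (w : 'cV[R]_(M + (D + n))) : 'cV[R]_M := usubmx w.
Definition yof (w : 'cV[R]_(M + (D + n))) : 'cV[R]_D := usubmx (dsubmx w).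
Definition lamof (w : 'cV[R]_(M + (D + n))) : 'cV[R]_n := dsubmx (dsubmx w).
Definition uof (w : 'cV[R]_(M + (D + n))) : 'cV[R]_(M + D) :=
  col_mx (xof w) (yof w).

Definition calA : 'M[R]_(n, M) := \mxrow_i AA P i.
Definition calB : 'M[R]_(n, D) := \mxrow_j BB P j.

Definition calX : set 'cV[R]_M := [set x | forall i, XX P i (submxcol x i)].
Definition calY : set 'cV[R]_D := [set y | forall j, YY P j (submxcol y j)].
Definition calM : set 'cV[R]_(M + (D + n)) :=
  [set w | calX (xof w) /\ calY (yof w)].

Definition hh (u : 'cV[R]_(M + D)) : R :=
  \sum_i ff P i (submxcol (usubmx u) i) + \sum_j gg P j (submxcol (dsubmx u) j).

Definition resid (x : 'cV[R]_M) (y : 'cV[R]_D) : 'cV[R]_n :=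
  calA *m x + calB *m y - cc P.

Definition feasible : set 'cV[R]_(M + D) :=
  [set u | [/\ calX (usubmx u), calY (dsubmx u)
             & calA *m usubmx u + calB *m dsubmx u = cc P]].

Definition solution_set : set 'cV[R]_(M + D) :=
  [set u | is_argmin feasible hh u].

Record standing_assumptions : Prop := {
  ff_closed_convex : forall i, closed_convex_fun (ff P i) ;
  gg_closed_convex : forall j, closed_convex_fun (gg P j) ;
  AA_full_col_rank : forall i, \rank (AA P i) = m i ;
  BB_full_col_rank : forall j, \rank (BB P j) = d j ;
  XX_closed : forall i, closed (XX P i) ;
  XX_convex : forall i, convex_set (XX P i) ;
  YY_closed : forall j, closed (YY P j) ;
  YY_convex : forall j, convex_set (YY P j) ;
  solution_nonempty : solution_set !=set0
}.

Definition calJ (w : 'cV[R]_(M + (D + n))) : 'cV[R]_(M + (D + n)) :=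
  col_mx (- (calA^T *m lamof w))
    (col_mx (- (calB^T *m lamof w)) (resid (xof w) (yof w))).

Definition lagr (beta : R) (x : 'cV[R]_M) (y : 'cV[R]_D) (lam : 'cV[R]_n) : R :=
  hh (col_mx x y) - dotv lam (resid x y) + beta / 2 * sqnorm (resid x y).

Definition lam_half (beta tau : R) (w w' : 'cV[R]_(M + (D + n))) : 'cV[R]_n :=
  lamof w - (tau * beta) *: resid (xof w') (yof w).

Definition gsadmm_step (beta sigma1 sigma2 tau s : R)
    (w w' : 'cV[R]_(M + (D + n))) : Prop :=
  [/\ forall i, is_argmin (XX P i)
        (fun z => lagr beta (set_block (xof w) i z) (yof w) (lamof w)
           + sigma1 * beta / 2 * sqnorm (AA P i *m (z - submxcol (xof w) i)))
        (submxcol (xof w') i),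
      forall j, is_argmin (YY P j)
        (fun z => lagr beta (xof w') (set_block (yof w) j z) (lam_half beta tau w w')
           + sigma2 * beta / 2 * sqnorm (BB P j *m (z - submxcol (yof w) j)))
        (submxcol (yof w') j)
    & lamof w' = lam_half beta tau w w' - (s * beta) *: resid (xof w') (yof w')].

Definition gsadmm (beta sigma1 sigma2 tau s : R)
    (w : nat -> 'cV[R]_(M + (D + n))) : Prop :=
  calM (w 0%N) /\ forall k, gsadmm_step beta sigma1 sigma2 tau s (w k) (w k.+1).

Definition lam_tilde (beta : R) (w : nat -> 'cV[R]_(M + (D + n))) (k : nat) :
    'cV[R]_n :=
  lamof (w k) - beta *: resid (xof (w k.+1)) (yof (w k)).

Definition w_tilde (beta : R) (w : nat -> 'cV[R]_(M + (D + n))) (k : nat) :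
    'cV[R]_(M + (D + n)) :=
  col_mx (xof (w k.+1)) (col_mx (yof (w k.+1)) (lam_tilde beta w k)).

Definition u_tilde (w : nat -> 'cV[R]_(M + (D + n))) (k : nat) : 'cV[R]_(M + D) :=
  col_mx (xof (w k.+1)) (yof (w k.+1)).

Definition w_avg (beta : R) (w : nat -> 'cV[R]_(M + (D + n))) (t : nat) :
    'cV[R]_(M + (D + n)) :=
  t%:R^-1 *: \sum_(1 <= k < t.+1) w_tilde beta w k.

Definition u_avg (w : nat -> 'cV[R]_(M + (D + n))) (t : nat) : 'cV[R]_(M + D) :=
  t%:R^-1 *: \sum_(1 <= k < t.+1) u_tilde w k.

Definition D_A : 'M[R]_M := \mxdiag_i ((AA P i)^T *m AA P i).
Definition D_B : 'M[R]_D := \mxdiag_j ((BB P j)^T *m BB P j).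

Definition H_x (beta sigma1 : R) : 'M[R]_M :=
  beta *: ((sigma1 + 1) *: D_A - calA^T *m calA).

Definition H_y (beta sigma2 : R) : 'M[R]_D :=
  beta *: ((sigma2 + 1) *: D_B - calB^T *m calB).

Definition H_mx (beta sigma1 sigma2 tau s : R) : 'M[R]_(M + (D + n)) :=
  block_mx (H_x beta sigma1) 0 0
    (block_mx
      (beta *: ((sigma2 + 1) *: D_B - (tau * s / (tau + s)) *: (calB^T *m calB)))
      (- (tau / (tau + s)) *: calB^T)
      (- (tau / (tau + s)) *: calB)
      ((beta * (tau + s))^-1)%:M).

End GSADMM.

Definition regionK (R : realType) : set (R * R) :=
  [set z | [/\ 0 < z.1 + z.2, z.1 <= 1 &
    0 < - z.1 ^+ 2 - z.2 ^+ 2 - z.1 * z.2 + z.1 + z.2 + 1]].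

(* Main.v *)
Require Import Defs.
From HB Require Import structures.
From mathcomp Require Import all_boot all_order all_algebra.
From mathcomp Require Import all_classical all_reals all_analysis.
From mathcomp Require Import ring lra.

Import Order.TTheory GRing.Theory Num.Theory.
Import numFieldNormedType.Exports.

Local Open Scope classical_set_scope.
Local Open Scope ring_scope.

(* Optimality of each block subproblem is a variational inequality; summed over
   the blocks, and after substituting the multiplier updates, it bounds the
   primal-dual gap at step [k] by
   [1/2 (|w - w^k|_H^2 - |w - w^(k+1)|_H^2 - G_k)], where, with
   [e = B (y^k - y^(k+1))] and [r_k] the residual at [w^k],
   [G_k = |y^(k+1) - y^k|_Hy^2
     + beta ((1 - tau) |e|^2 + (2 - tau - s) |r_(k+1)|^2 + 2 (1 - tau) <e, r_(k+1)>)].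
   The inner product [<e, r_(k+1)>] is bounded below by adding the [y]-inequalities
   of two consecutive steps, each tested at the other's iterate. Completing the
   square then gives, for [(tau, s)] in [K],
   [G_k >= xi3 (|r_(k+1)|^2 - |r_k|^2)
     + xi4 (|y^(k+1) - y^k|_Hy^2 - |y^k - y^(k-1)|_Hy^2)],
   with [xi3 = beta (1 - s)^2 / (1 + tau)] and [xi4 = (1 - tau) / (1 + tau)].
   Everything telescopes, [H] is positive semidefinite, and Jensen's inequality
   passes to the averages. *)

(** * Euclidean inner product *)

Section Dotv.
Context {R : realType} {k : nat}.
Implicit Types (u v w : 'cV[R]_k) (a : R).

Lemma dotvE u v : dotv u v = \sum_i u i 0 * v i 0.
Proof. by rewrite /dotv mxE; apply: eq_bigr => i _; rewrite mxE. Qed.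

Lemma dotvC u v : dotv u v = dotv v u.
Proof. by rewrite !dotvE; apply: eq_bigr => i _; rewrite mulrC. Qed.

Lemma dotvDl u v w : dotv (u + v) w = dotv u w + dotv v w.
Proof. by rewrite /dotv linearD mulmxDl mxE. Qed.

Lemma dotvDr u v w : dotv w (u + v) = dotv w u + dotv w v.
Proof. by rewrite /dotv mulmxDr mxE. Qed.

Lemma dotvNl u v : dotv (- u) v = - dotv u v.
Proof. by rewrite /dotv linearN mulNmx mxE. Qed.

Lemma dotvNr u v : dotv v (- u) = - dotv v u.
Proof. by rewrite /dotv mulmxN mxE. Qed.

Lemma dotvZl a u v : dotv (a *: u) v = a * dotv u v.
Proof. by rewrite /dotv linearZ -scalemxAl mxE. Qed.

Lemma dotvZr a u v : dotv v (a *: u) = a * dotv v u.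
Proof. by rewrite /dotv -scalemxAr mxE. Qed.

Lemma dotv0l v : dotv 0 v = 0.
Proof. by rewrite -(scale0r 0) dotvZl mul0r. Qed.

Lemma dotv_suml (I : Type) (r : seq I) (Q : pred I) (F : I -> 'cV[R]_k) v :
  dotv (\sum_(i <- r | Q i) F i) v = \sum_(i <- r | Q i) dotv (F i) v.
Proof.
by elim/big_rec2: _ => [|i x y _ <-]; rewrite ?dotv0l// dotvDl.
Qed.

Lemma sqnorm_ge0 u : 0 <= sqnorm u.
Proof. by rewrite /sqnorm dotvE sumr_ge0// => i _; rewrite -expr2 sqr_ge0. Qed.

Definition dotvlin := (dotvDl, dotvDr, dotvNl, dotvNr, dotvZl, dotvZr).

End Dotv.

Lemma dotv_mulmx (R : realType) (k l : nat) (A : 'M[R]_(k, l)) u v :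
  dotv (A *m u) v = dotv u (A^T *m v).
Proof. by rewrite /dotv trmx_mul mulmxA. Qed.

Lemma dotv_col_mx (R : realType) (k l : nat) (u u' : 'cV[R]_k) (v v' : 'cV[R]_l) :
  dotv (col_mx u v) (col_mx u' v') = dotv u u' + dotv v v'.
Proof. by rewrite /dotv tr_col_mx mul_row_col mxE. Qed.

Lemma sqnorm_mxE (R : realType) (k : nat) (S : 'M[R]_k) (v : 'cV[R]_k) :
  sqnorm_mx S v = dotv v (S *m v).
Proof. by rewrite /sqnorm_mx /dotv mulmxA. Qed.

(** * Stacked vectors and block rows *)

Section Blocks.
Context {R : realType} {p n : nat} {m : 'I_p -> nat}.
Context (A : forall i, 'M[R]_(n, m i)).
Local Notation M := (\sum_i m i)%N.
Local Notation cA := (\mxrow_i A i).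
Implicit Types (u v w x : 'cV[R]_M).

(** The bilinear form of [D_A] (or [D_B]), written blockwise so that sums of block inequalities
    produce it directly; [blockformE] is the link with the matrix. *)
Definition blockform u v : R :=
  \sum_i dotv (A i *m submxcol u i) (A i *m submxcol v i).

Lemma blockformC u v : blockform u v = blockform v u.
Proof. by apply: eq_bigr => i _; rewrite dotvC. Qed.

Lemma blockformDl u v w : blockform (u + v) w = blockform u w + blockform v w.
Proof.
rewrite -big_split; apply: eq_bigr => i _.
by rewrite submxcolD mulmxDr dotvDl.
Qed.

Lemma blockformNl u v : blockform (- u) v = - blockform u v.
Proof.
rewrite -sumrN; apply: eq_bigr => i _.
by rewrite submxcolN mulmxN dotvNl.
Qed.

Lemma blockformDr u v w : blockform w (u + v) = blockform w u + blockform w v.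
Proof. by rewrite blockformC blockformDl !(blockformC w). Qed.

Lemma blockformNr u v : blockform v (- u) = - blockform v u.
Proof. by rewrite blockformC blockformNl (blockformC v). Qed.

Definition blockformlin := (blockformDl, blockformDr, blockformNl, blockformNr).

Lemma mulmx_rowE x : cA *m x = \sum_i A i *m submxcol x i.
Proof. by rewrite -[x in LHS]submxcolK mul_mxrow_mxcol. Qed.

Lemma blockformE u v :
  blockform u v = dotv u (\mxdiag_i ((A i)^T *m A i) *m v).
Proof.
rewrite -[v in RHS]submxcolK mul_mxdiag_mxcol -[u in RHS]submxcolK.
rewrite /dotv tr_mxcol mul_mxrow_mxcol summxE; apply: eq_bigr => i _.
by rewrite /dotv trmx_mul !mulmxA.
Qed.

Lemma set_blockE x i z l :
  submxcol (set_block x i z) l = dfwith (fun l => submxcol x l) i z l.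
Proof. by rewrite /set_block mxcolK. Qed.

Lemma mulmx_set_block x i (z : 'cV[R]_(m i)) :
  cA *m set_block x i z = cA *m x + A i *m (z - submxcol x i).
Proof.
rewrite !mulmx_rowE (bigD1 i)//= [in RHS](bigD1 i)//= set_blockE dfwithin.
rewrite mulmxBr [RHS]addrC addrA subrK; congr (_ + _).
by apply: eq_bigr => l li; rewrite set_blockE dfwithout// eq_sym.
Qed.

(* Cauchy-Schwarz over the [p] blocks, through
   [0 <= \sum_i \sum_l |A_i x_i - A_l x_l|^2]. *)
Lemma sqnorm_mulmx_row_le x : sqnorm (cA *m x) <= p%:R * blockform x x.
Proof.
pose a i := A i *m submxcol x i.
have : 0 <= \sum_i \sum_l sqnorm (a i - a l).
  by apply: sumr_ge0 => i _; apply: sumr_ge0 => l _; exact: sqnorm_ge0.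
have -> : \sum_i \sum_l sqnorm (a i - a l)
    = 2 * (p%:R * blockform x x - sqnorm (cA *m x)).
  have S1 : \sum_(i < p) \sum_(l < p) dotv (a i) (a i) = p%:R * blockform x x.
    rewrite /blockform mulr_sumr; apply: eq_bigr => i _.
    by rewrite sumr_const card_ord mulr_natl.
  have S2 : \sum_i \sum_l dotv (a i) (a l) = sqnorm (cA *m x).
    rewrite /sqnorm mulmx_rowE dotv_suml; apply: eq_bigr => i _.
    by rewrite dotvC dotv_suml; apply: eq_bigr => l _; exact: dotvC.
  rewrite -S1 -S2 mulrBr mulr_natl mulr2n [X in _ + X - _]exchange_big.
  rewrite mulr_sumr -big_split -sumrB; apply: eq_bigr => i _.
  rewrite mulr_sumr -big_split -sumrB; apply: eq_bigr => l _.
  by rewrite /sqnorm !dotvlin (dotvC (a l) (a i)) /=; ring.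
by move=> h; lra.
Qed.

End Blocks.

(** * Convexity along segments and Jensen's inequality *)

Lemma affine_ge0_at0 (R : realFieldType) (a b : R) :
  (forall t, 0 < t -> t <= 1 -> 0 <= a + t * b) -> 0 <= a.
Proof.
move=> h; case: (leP 0 a) => // a0.
have c0 : 0 < 1 + `|b| - a by have := normr_ge0 b; lra.
(* If [a < 0], this value [t] gives [a + t * b <= a + t * |b| = - t * (1 - a) < 0], a
   contradiction. *)
have t0 : 0 < - a / (1 + `|b| - a) by rewrite divr_gt0// oppr_gt0.
have t1 : - a / (1 + `|b| - a) <= 1.
  by rewrite ler_pdivrMr//; have := normr_ge0 b; lra.
have := h _ t0 t1; set t := _ / _ => ht.
have tE : t * (1 + `|b| - a) = - a by rewrite /t divfK// gt_eqF.
have : t * b <= t * `|b| by rewrite ler_pM2l// ler_norm.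
by nra.
Qed.

Lemma convex_setP (R : realType) (V : lmodType R) (S : set V) (x y : V) (t : R) :
  convex_set S -> 0 <= t -> t <= 1 -> S x -> S y -> S (x + t *: (y - x)).
Proof.
move=> cS t0 t1 Sx Sy.
have t01 : Itv.spec (@Itv.num_sem R) (Itv.Real `[0%Z, 1%Z]) t.
  by rewrite /Itv.spec /Itv.num_sem/= in_itv/= t0 t1 num_real.
have := cS y x (Itv.mk t01) (mem_set Sy) (mem_set Sx).
rewrite inE /conv/=; congr S.
by rewrite scalerBr scalerBl scale1r addrCA.
Qed.

Lemma convex_functionP (R : realType) (V : lmodType R) (f : V -> R) (x y : V) (t : R) :
  convex_function setT f -> 0 <= t -> t <= 1 ->
  f (x + t *: (y - x)) <= f x + t * (f y - f x).
Proof.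
move=> cf t0 t1.
have t01 : Itv.spec (@Itv.num_sem R) (Itv.Real `[0%Z, 1%Z]) t.
  by rewrite /Itv.spec /Itv.num_sem/= in_itv/= t0 t1 num_real.
have := cf (Itv.mk t01) y x (mem_set I) (mem_set I).
rewrite /conv/= => h.
have -> : x + t *: (y - x) = t *: (y : V) + (1 - t) *: x.
  by rewrite scalerBr scalerBl scale1r addrCA.
apply: le_trans h _; rewrite le_eqVlt; apply/orP; left; apply/eqP.
rewrite [LHS](_ : _ = t * f y + (1 - t) * f x)//; ring.
Qed.

(** Jensen by induction: the new average lies on the segment from the old average to the new point,
    at parameter one over the new number of points. *)
Lemma convex_function_avg (R : realType) (V : lmodType R) (f : V -> R)
    (z : nat -> V) (t : nat) : convex_function setT f -> (0 < t)%N ->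
  f (t%:R^-1 *: \sum_(1 <= k < t.+1) z k)
    <= t%:R^-1 * \sum_(1 <= k < t.+1) f (z k).
Proof.
move=> cf; elim: t => // -[_ _|t IH _].
  by rewrite !big_nat1 invr1 scale1r mul1r.
have {}IH := IH isT; rewrite !(big_nat_recr t.+2)//=.
set S := \sum_(_ <= _ < _) z _ in IH *; set F := \sum_(_ <= _ < _) f _ in IH *.
have T0 : 0 < t.+1%:R :> R by rewrite ltr0n.
have T2 : t.+2%:R = t.+1%:R + 1 :> R by rewrite -natr1.
rewrite T2; set T := t.+1%:R in T0 IH *.
have -> : (T + 1)^-1 *: (S + z t.+2) =
    T^-1 *: S + (T + 1)^-1 *: (z t.+2 - T^-1 *: S).
  rewrite scalerBr scalerA scalerDr addrCA [LHS]addrC; congr (_ + _).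
  by rewrite -scalerBl; congr (_ *: _); field; rewrite !gt_eqF//; lra.
apply: (le_trans (convex_functionP _ _ f _ _ _ cf _ _)).
- by rewrite invr_ge0; lra.
- by rewrite invf_le1; lra.
have -> : (T + 1)^-1 * (F + f (z t.+2)) =
    T^-1 * F + (T + 1)^-1 * (f (z t.+2) - T^-1 * F).
  by field; rewrite !gt_eqF//; lra.
have c1 : 0 <= 1 - (T + 1)^-1 by rewrite subr_ge0 invf_le1; lra.
move: (ler_wpM2l c1 IH); rewrite !mulrBl !mul1r !mulrBr.
move: (f (T^-1 *: S)) (f (z t.+2)) (T^-1 * F) (T + 1)^-1 => a b c e.
by lra.
Qed.

(** * Variational inequalities for the subproblems *)

Lemma is_argmin_ext (R : realType) (T : Type) (S : set T) (F G : T -> R) z :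
  F =1 G -> is_argmin S F z -> is_argmin S G z.
Proof. by move=> FG [Sz h]; split=> // y Sy; rewrite -!FG; exact: h. Qed.

(** First-order optimality without differentiating [f]: the minimizer is compared with
    [z' + t *: (z - z')], convexity bounds [f] there, and after division by [t] only the quadratic
    part leaves a term in [t], which [affine_ge0_at0] removes. *)
Lemma argmin_vi (R : realType) (k l : nat) (f : 'cV[R]_k -> R) (S : set 'cV[R]_k)
    (A : 'M[R]_(l, k)) (lam b : 'cV[R]_l) (z0 z' : 'cV[R]_k) (C beta gamma : R) :
  convex_function setT f -> convex_set S ->
  is_argmin S (fun z => f z + C - dotv lam (b + A *m z)
     + beta / 2 * sqnorm (b + A *m z) + gamma / 2 * sqnorm (A *m (z - z0))) z' ->
  forall z, S z -> f z' <= f z +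
    dotv (A *m (z - z')) (beta *: (b + A *m z') - lam + gamma *: (A *m (z' - z0))).
Proof.
move=> cf cS [Sz' h] z Sz; rewrite -subr_ge0.
apply: (@affine_ge0_at0 _ _ ((beta + gamma) / 2 * sqnorm (A *m (z - z')))) => t t0 t1.
have := h _ (convex_setP _ _ _ _ _ _ cS (ltW t0) t1 Sz' Sz).
have := convex_functionP _ _ f z' z _ cf (ltW t0) t1.
rewrite (addrAC z'); set v0 := z' - z0; rewrite !(mulmxDr A _ (t *: _)) -scalemxAr.
move: (A *m (z - z')) (A *m z') (A *m v0) => u w v.
set ft := f _ => hf hm.
rewrite -(pmulr_rge0 _ t0).
move: hm hf; rewrite /sqnorm !dotvlin.
rewrite (dotvC u lam) (dotvC u b) (dotvC u v) (dotvC u w).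
by lra.
Qed.

(** All blocks are updated from the same [x], so the gradient of block [i] is taken at the old
    residual plus [A i] applied to its own increment. That increment joins the proximal term, whence
    the factor [sigma + 1]. *)
Lemma block_argmin_vi (R : realType) (p n : nat) (m : 'I_p -> nat)
    (f : forall i, 'cV[R]_(m i) -> R) (A : forall i, 'M[R]_(n, m i))
    (S : forall i, set 'cV[R]_(m i)) (x x' : 'cV[R]_(\sum_i m i))
    (lam b : 'cV[R]_n) (C beta sigma : R) :
  (forall i, convex_function setT (f i)) -> (forall i, convex_set (S i)) ->
  (forall i, is_argmin (S i) (fun z =>
     \sum_l f l (submxcol (set_block x i z) l) + C
     - dotv lam (b + (\mxrow_i A i) *m set_block x i z)
     + beta / 2 * sqnorm (b + (\mxrow_i A i) *m set_block x i z)
     + sigma * beta / 2 * sqnorm (A i *m (z - submxcol x i))) (submxcol x' i)) ->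
  forall v, (forall i, S i (submxcol v i)) ->
  \sum_i f i (submxcol x' i) <= \sum_i f i (submxcol v i)
    + dotv ((\mxrow_i A i) *m (v - x')) (beta *: (b + (\mxrow_i A i) *m x) - lam)
    + beta * (sigma + 1) * blockform A (v - x') (x' - x).
Proof.
move=> cf cS hmin v Sv.
rewrite mulmx_rowE dotv_suml /blockform mulr_sumr -!big_split.
apply: ler_sum => i _ /=.
(* [Ci] and [bi] hold the contributions of the other blocks, frozen at [x]. *)
pose Ci := C + \sum_(l | l != i) f l (submxcol x l).
pose bi := b + (\mxrow_i A i) *m x - A i *m submxcol x i.
have := @argmin_vi R _ _ (f i) (S i) (A i) lam bi (submxcol x i) (submxcol x' i)
  Ci beta (sigma * beta) (cf i) (cS i) _ _ (Sv i).
rewrite !submxcolB => /(_ _)/le_trans; apply.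
  apply: is_argmin_ext (hmin i) => z /=.
  rewrite mulmx_set_block mulmxBr.
  have -> : b + (\mxrow_i A i *m x + (A i *m z - A i *m submxcol x i))
      = bi + A i *m z by rewrite /bi -!addrA; congr (_ + (_ + _)); rewrite addrC.
  congr (_ - _ + _ + _); rewrite (bigD1 i)//= set_blockE dfwithin /Ci.
  rewrite -addrA; congr (_ + _); rewrite addrC; congr (_ + _).
  by apply: eq_bigr => l li; rewrite set_blockE dfwithout// eq_sym.
rewrite le_eqVlt; apply/orP; left; apply/eqP.
rewrite /bi !mulmxBr !dotvlin; ring.
Qed.

(** * Seminorms of [H_x] and [H_y], the region K, and the algebra of one step *)

Lemma sqnorm_mx_blockE (R : realType) (p n : nat) (m : 'I_p -> nat)
    (A : forall i, 'M[R]_(n, m i)) (beta sigma : R) (v : 'cV[R]_(\sum_i m i)) :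
  sqnorm_mx (beta *: ((sigma + 1) *: (\mxdiag_i ((A i)^T *m A i))
      - (\mxrow_i A i)^T *m (\mxrow_i A i))) v
  = beta * ((sigma + 1) * blockform A v v - sqnorm ((\mxrow_i A i) *m v)).
Proof.
rewrite sqnorm_mxE -scalemxAl mulmxBl -scalemxAl !dotvlin blockformE.
by rewrite /sqnorm [in RHS]dotv_mulmx -mulmxA.
Qed.

(** Since [sigma + 1 > p], the block Cauchy-Schwarz bound absorbs the subtracted square. *)
Lemma sqnorm_mx_block_ge0 (R : realType) (p n : nat) (m : 'I_p -> nat)
    (A : forall i, 'M[R]_(n, m i)) (beta sigma : R) (v : 'cV[R]_(\sum_i m i)) :
  0 < beta -> p%:R - 1 < sigma ->
  0 <= sqnorm_mx (beta *: ((sigma + 1) *: (\mxdiag_i ((A i)^T *m A i))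
      - (\mxrow_i A i)^T *m (\mxrow_i A i))) v.
Proof.
move=> b0 hs; rewrite sqnorm_mx_blockE mulr_ge0 ?(ltW b0)// subr_ge0.
apply: le_trans (sqnorm_mulmx_row_le A v) _; apply: ler_wpM2r; last by lra.
by apply: sumr_ge0 => i _; exact: sqnorm_ge0.
Qed.

Lemma regionK_bounds (R : realType) (tau s : R) : regionK (tau, s) ->
  [/\ 0 < tau + s, tau <= 1, 0 < 1 + tau
    & (1 - s) ^+ 2 / (1 + tau) <= 2 - tau - s].
Proof.
move=> [/= h1 h2 h3].
have t1 : 0 < 1 + tau.
  (* This product is four times the quadratic defining K plus [(2 * s + tau - 1) ^+ 2]. *)
  have : 0 < (5 - 3 * tau) * (1 + tau) by have := sqr_ge0 (2 * s + tau - 1); nra.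
  by rewrite pmulr_rgt0//; lra.
(* [(2 - tau - s) * (1 + tau) - (1 - s) ^+ 2] is exactly the quadratic defining K. *)
split=> //; rewrite ler_pdivrMr//; nra.
Qed.

(* [X = A (x - x^(k+1))], [Y = B (y - y^(k+1))], [dX = A (x^(k+1) - x^k)],
   [e = B (y^k - y^(k+1))], [r] the new residual, [l0 = lambda^k]. The left-hand
   side collects the terms of the variational inequalities and of the gap that
   do not involve [D_A], [D_B]. *)
Lemma step_identity (R : realType) (k : nat) (X Y dX e r l0 l : 'cV[R]_k)
    (beta tau s : R) : beta != 0 -> tau + s != 0 ->
  dotv X (beta *: (r + e - dX) - l0)
  + dotv Y (beta *: (r + e) - (l0 - (tau * beta) *: (r + e)))
  + dotv X l + dotv Y l + dotv (l0 - beta *: (r + e) - l) (r + X + Y)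
  + beta / 2 * ((1 - tau) * sqnorm e + (2 - tau - s) * sqnorm r
               + 2 * (1 - tau) * dotv e r - sqnorm e)
  = beta / 2 * (sqnorm X + sqnorm dX - sqnorm (X + dX))
  + beta * tau / 2 * (sqnorm Y - sqnorm (Y - e))
  + (2 * (beta * (tau + s)))^-1 *
    (sqnorm (l - l0 - (tau * beta) *: (Y - e))
     - sqnorm (l - (l0 - (tau * beta) *: (r + e) - (s * beta) *: r)
               - (tau * beta) *: Y)).
Proof.
move=> b0 ts0; rewrite /sqnorm !dotvlin.
rewrite ?(dotvC Y X) ?(dotvC dX X) ?(dotvC e X) ?(dotvC r X) ?(dotvC l0 X) ?(dotvC l X).
rewrite ?(dotvC dX Y) ?(dotvC e Y) ?(dotvC r Y) ?(dotvC l0 Y) ?(dotvC l Y).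
rewrite ?(dotvC e r) ?(dotvC l0 r) ?(dotvC l r).
rewrite ?(dotvC l0 e) ?(dotvC l e) ?(dotvC l l0).
by field; rewrite b0 ts0.
Qed.

(** * Decomposition of the [H]-seminorm and convexity of the objective *)

Section Convergence.
Context (R : realType) (p q n : nat) (m : 'I_p -> nat) (d : 'I_q -> nat).
Context (P : problem R n m d) (beta sigma1 sigma2 tau s : R).
Local Notation W := 'cV[R]_(\sum_i m i + (\sum_j d j + n)).
Implicit Types (w : W).

Lemma xofB w w' : xof (w - w') = xof w - xof w'.
Proof. exact: linearB. Qed.

Lemma yofB w w' : yof (w - w') = yof w - yof w'.
Proof. by rewrite /yof !linearB. Qed.

Lemma lamofB w w' : lamof (w - w') = lamof w - lamof w'.
Proof. by rewrite /lamof !linearB. Qed.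

Lemma wofE w : w = col_mx (xof w) (col_mx (yof w) (lamof w)).
Proof. by rewrite /xof /yof /lamof !vsubmxK. Qed.

(** Completing the square in the multiplier: the square returns [beta * tau ^+ 2 / (tau + s)] times
    [|B y|^2], and [- 1 + (1 - tau) + tau ^+ 2 / (tau + s) = - (tau * s) / (tau + s)]. For
    [tau <= 1] every summand is then nonnegative. *)
Lemma H_mxE w : 0 < beta -> 0 < tau + s ->
  sqnorm_mx (H_mx P beta sigma1 sigma2 tau s) w
  = sqnorm_mx (H_x P beta sigma1) (xof w) + sqnorm_mx (H_y P beta sigma2) (yof w)
    + beta * (1 - tau) * sqnorm (calB P *m yof w)
    + (beta * (tau + s))^-1 * sqnorm (lamof w - (tau * beta) *: (calB P *m yof w)).
Proof.
move=> b0 ts0.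
rewrite [w in LHS]wofE sqnorm_mxE /H_mx !mul_block_col !mul0mx addr0 add0r.
rewrite !dotv_col_mx -sqnorm_mxE -!addrA; congr (_ + _).
rewrite sqnorm_mxE /H_y -!scalemxAl !mulmxBl -!scalemxAl mul_scalar_mx.
set y := yof w; set l := lamof w.
rewrite /sqnorm !dotvlin -!mulmxA -!dotv_mulmx.
rewrite (dotvC l).
by field; rewrite !gt_eqF.
Qed.

Lemma hh_convex : (forall i, convex_function setT (ff P i)) ->
  (forall j, convex_function setT (gg P j)) -> convex_function setT (hh P).
Proof.
move=> cf cg t x y _ _; set z := conv t x y.
have zi i : submxcol (usubmx z) i
    = conv t (submxcol (usubmx x) i : convex_lmodType _) (submxcol (usubmx y) i).
  by apply/matrixP => a b; rewrite /z /conv/= !mxE.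
have zj j : submxcol (dsubmx z) j
    = conv t (submxcol (dsubmx x) j : convex_lmodType _) (submxcol (dsubmx y) j).
  by apply/matrixP => a b; rewrite /z /conv/= !mxE.
rewrite [leRHS](_ : _ = t%:num * hh P x + (1 - t%:num) * hh P y)// /hh.
rewrite !mulrDr addrACA !mulr_sumr -!big_split lerD//; apply: ler_sum => i _.
  by rewrite zi; apply: cf; exact: mem_set.
by rewrite zj; apply: cg; exact: mem_set.
Qed.

(** * Inequalities for one step and for two consecutive steps *)

Hypotheses (hP : standing_assumptions P) (hbeta : 0 < beta).

Lemma x_step_vi w w' x : gsadmm_step P beta sigma1 sigma2 tau s w w' -> calX P x ->
  \sum_i ff P i (submxcol (xof w') i) <= \sum_i ff P i (submxcol x i)
    + dotv (calA P *m (x - xof w')) (beta *: resid P (xof w) (yof w) - lamof w)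
    + beta * (sigma1 + 1) * blockform (AA P) (x - xof w') (xof w' - xof w).
Proof.
move=> [hx _ _] Xx.
have -> : resid P (xof w) (yof w) = calB P *m yof w - cc P + calA P *m xof w.
  by rewrite /resid -addrA addrC.
apply: (@block_argmin_vi R p n m (ff P) (AA P) (XX P) _ _ _ _
  (\sum_j gg P j (submxcol (yof w) j))) => //.
- by move=> i; case: (ff_closed_convex hP i).
- exact: XX_convex hP.
move=> i; apply: is_argmin_ext (hx i) => z /=.
by rewrite /lagr /hh /resid col_mxKu col_mxKd -!(addrA (calA P *m _))
  !(addrC (calA P *m _)).
Qed.

Lemma y_step_vi w w' y : gsadmm_step P beta sigma1 sigma2 tau s w w' -> calY P y ->
  \sum_j gg P j (submxcol (yof w') j) <= \sum_j gg P j (submxcol y j)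
    + dotv (calB P *m (y - yof w'))
        (beta *: resid P (xof w') (yof w) - lam_half P beta tau w w')
    + beta * (sigma2 + 1) * blockform (BB P) (y - yof w') (yof w' - yof w).
Proof.
move=> [_ hy _] Yy.
have -> : resid P (xof w') (yof w) = calA P *m xof w' - cc P + calB P *m yof w.
  by rewrite /resid addrAC.
apply: (@block_argmin_vi R q n d (gg P) (BB P) (YY P) _ _ _ _
  (\sum_i ff P i (submxcol (xof w') i))) => //.
- by move=> j; case: (gg_closed_convex hP j).
- exact: YY_convex hP.
move=> j; apply: is_argmin_ext (hy j) => z /=.
by rewrite /lagr /hh /resid col_mxKu col_mxKd (addrAC (calA P *m _))
   (addrC (\sum_i _)).
Qed.

Local Notation normHx := (sqnorm_mx (H_x P beta sigma1)).
Local Notation normHy := (sqnorm_mx (H_y P beta sigma2)).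
Local Notation normH := (sqnorm_mx (H_mx P beta sigma1 sigma2 tau s)).
Local Notation res w := (resid P (xof w) (yof w)).

Lemma residE x' y' x y : resid P x y
  = resid P x' y' + calA P *m (x - x') + calB P *m (y - y').
Proof.
rewrite /resid !mulmxBr; move: (calA P *m x) (calA P *m x') (calB P *m y) => a b c.
by apply/matrixP => i j; rewrite !mxE; ring.
Qed.

Lemma lamof_step w0 w1 : gsadmm_step P beta sigma1 sigma2 tau s w0 w1 ->
  lamof w1 = lamof w0
    - (tau * beta) *: (res w1 + calB P *m (yof w0 - yof w1)) - (s * beta) *: res w1.
Proof.
move=> [_ _ ->]; rewrite /lam_half (residE (xof w1) (yof w1) (xof w1)).
by rewrite subrr mulmx0 addr0.
Qed.

Lemma cross_term_bound w0 w1 w2 : q%:R - 1 < sigma2 ->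
  gsadmm_step P beta sigma1 sigma2 tau s w0 w1 ->
  gsadmm_step P beta sigma1 sigma2 tau s w1 w2 ->
  let e := calB P *m (yof w1 - yof w2) in
  (normHy (yof w2 - yof w1) - normHy (yof w1 - yof w0)) / 2
  <= beta * ((1 + tau) * dotv e (res w2) + tau * sqnorm e
             - (1 - s) * dotv e (res w1)).
Proof.
move=> hs st1 st2; cbv zeta.
have Y1 : calY P (yof w1) by move=> j; case: st1 => _ /(_ j)[].
have Y2 : calY P (yof w2) by move=> j; case: st2 => _ /(_ j)[].
have := lerD (y_step_vi _ _ _ st2 Y1) (y_step_vi _ _ _ st1 Y2).
(* With both half-step multipliers expressed through [lamof w1], that vector cancels in the sum, as
   do the values of [g]. *)
have -> : lam_half P beta tau w0 w1 = lamof w1 + (s * beta) *: res w1.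
  by case: st1 => _ _ ->; rewrite subrK.
rewrite /lam_half (residE (xof w2) (yof w2) (xof w2) (yof w1)).
rewrite (residE (xof w1) (yof w1) (xof w1) (yof w0)) !subrr !mulmx0 !addr0.
(* Nonnegativity at the difference of the two increments bounds their mixed [H_y] product by the
   half sum of their squares. *)
have := @sqnorm_mx_block_ge0 _ _ _ _ (BB P) beta sigma2
  (yof w2 - yof w1 - (yof w1 - yof w0)) hbeta hs.
rewrite !(sqnorm_mx_blockE _ _ _ _ (BB P)) -/(calB P).
rewrite -[yof w1 - yof w2]opprB -[yof w0 - yof w1]opprB.
rewrite (mulmxBr _ (_ - _)) !mulmxN; set u := yof w2 - yof w1; set v := yof w1 - yof w0.
move: (calB P *m u) (calB P *m v) (res w1) (res w2) (lamof w1) => a b r1 r2 l.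
clearbody u v; rewrite /sqnorm !dotvlin !blockformlin (blockformC _ v u).
rewrite (dotvC b a).
by lra.
Qed.

Lemma dotv_calJ w w' : dotv (w' - w) (calJ P w)
  = dotv (calA P *m (xof w - xof w')) (lamof w)
    + dotv (calB P *m (yof w - yof w')) (lamof w) + dotv (lamof w' - lamof w) (res w).
Proof.
rewrite [w' in LHS]wofE [X in _ - X]wofE !opp_col_mx !add_col_mx /calJ !dotv_col_mx.
by rewrite !dotvNr -!dotv_mulmx -!dotvNl -!mulmxN !opprB addrA.
Qed.

Lemma xof_col x y l : xof (col_mx x (col_mx y l) : W) = x.
Proof. exact: col_mxKu. Qed.

Lemma yof_col x y l : yof (col_mx x (col_mx y l) : W) = y.
Proof. by rewrite /yof col_mxKd col_mxKu. Qed.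

Lemma lamof_col x y l : lamof (col_mx x (col_mx y l) : W) = l.
Proof. by rewrite /lamof !col_mxKd. Qed.

Lemma one_step w0 w1 w : p%:R - 1 < sigma1 -> 0 < tau + s ->
  gsadmm_step P beta sigma1 sigma2 tau s w0 w1 -> calM P w ->
  let e := calB P *m (yof w0 - yof w1) in
  let lt := lamof w0 - beta *: resid P (xof w1) (yof w0) in
  hh P (col_mx (xof w1) (yof w1)) - hh P (uof w)
  + dotv (col_mx (xof w1) (col_mx (yof w1) lt) - w) (calJ P w)
  <= (normH (w - w0) - normH (w - w1)
      - (normHy (yof w1 - yof w0) + beta * ((1 - tau) * sqnorm e
      + (2 - tau - s) * sqnorm (res w1) + 2 * (1 - tau) * dotv e (res w1)))) / 2.
Proof.
move=> hs ts0 st [Xw Yw]; cbv zeta.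
(* Half of this square is the only term discarded beyond the two variational inequalities; the rest
   is [step_identity]. *)
have hdx := @sqnorm_mx_block_ge0 _ _ _ _ (AA P) beta sigma1
  (xof w1 - xof w0) hbeta hs.
have vx := x_step_vi _ _ _ st Xw.
have vy := y_step_vi _ _ _ st Yw.
have -> : hh P (col_mx (xof w1) (yof w1)) - hh P (uof w)
    = \sum_i ff P i (submxcol (xof w1) i) - \sum_i ff P i (submxcol (xof w) i)
    + (\sum_j gg P j (submxcol (yof w1) j) - \sum_j gg P j (submxcol (yof w) j)).
  by rewrite /hh !col_mxKu !col_mxKd; ring.
rewrite dotv_calJ /= !xof_col !yof_col !lamof_col.
rewrite !H_mxE// !xofB !yofB !lamofB (lamof_step _ _ st).
rewrite !(sqnorm_mx_blockE _ _ _ _ (BB P)) !(sqnorm_mx_blockE _ _ _ _ (AA P)).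
move: hdx vx vy; rewrite /lam_half !(sqnorm_mx_blockE _ _ _ _ (AA P)).
rewrite (residE (xof w1) (yof w1) (xof w) (yof w)).
rewrite (residE (xof w1) (yof w1) (xof w0) (yof w0)).
rewrite (residE (xof w1) (yof w1) (xof w1) (yof w0)) subrr mulmx0 addr0.
(* Everything is expressed by displacements from the new iterate and by the increments. *)
have -> : xof w - xof w0 = xof w - xof w1 + (xof w1 - xof w0) by rewrite addrA subrK.
have -> : yof w - yof w0 = yof w - yof w1 - (yof w0 - yof w1).
  by rewrite opprB addrA subrK.
rewrite -[xof w0 - xof w1]opprB -[yof w1 - yof w0]opprB.
set x := xof w - xof w1; set dx := xof w1 - xof w0.
set y := yof w - yof w1; set dy := yof w0 - yof w1.
have := step_identity _ _ (calA P *m x) (calB P *m y) (calA P *m dx)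
  (calB P *m dy) (res w1) (lamof w0) (lamof w) beta tau s
  (lt0r_neq0 hbeta) (lt0r_neq0 ts0).
rewrite -/(calA P) -/(calB P).
clearbody x dx y dy.
rewrite (mulmxDr _ x) !(mulmxBr _ y) !mulmxN.
move: (calA P *m x) (calA P *m dx) (calB P *m y) (calB P *m dy) (res w1)
  (lamof w0) (lamof w) => X dX Y e r l0 l.
rewrite !blockformlin (blockformC _ dx x) (blockformC _ dy y).
have -> : sqnorm (- e) = sqnorm e by rewrite /sqnorm dotvNl dotvNr opprK.
rewrite (addrAC r (- dX)) invfM.
move: (beta * (tau + s))^-1 (sqnorm _) (sqnorm _) => kappa a b.
by lra.
Qed.

(** * Descent of a potential, telescoping and averaging *)

Hypotheses (hsigma1 : p%:R - 1 < sigma1) (hsigma2 : q%:R - 1 < sigma2).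
Hypothesis hK : regionK (tau, s).

Let xi3 := beta * ((1 - s) ^+ 2 / (1 + tau)).
Let xi4 := (1 - tau) / (1 + tau).

Lemma sqnorm_H_ge0 w : 0 <= normH w.
Proof.
have [ts0 t1 _ _] := regionK_bounds _ _ _ hK.
rewrite H_mxE// !addr_ge0 ?sqnorm_mx_block_ge0//.
- by rewrite !mulr_ge0 ?sqnorm_ge0 ?(ltW hbeta)// subr_ge0.
- by rewrite mulr_ge0 ?sqnorm_ge0// invr_ge0 ltW// mulr_gt0.
Qed.

(* After [cross_term_bound], what remains is the square of
   [(1 - tau) e + (1 - s) r1], plus the last bound of [regionK_bounds]. *)
Lemma residual_descent w0 w1 w2 :
  gsadmm_step P beta sigma1 sigma2 tau s w0 w1 ->
  gsadmm_step P beta sigma1 sigma2 tau s w1 w2 ->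
  let e := calB P *m (yof w1 - yof w2) in
  xi3 * (sqnorm (res w2) - sqnorm (res w1))
  + xi4 * (normHy (yof w2 - yof w1) - normHy (yof w1 - yof w0))
  <= normHy (yof w2 - yof w1) + beta * ((1 - tau) * sqnorm e
      + (2 - tau - s) * sqnorm (res w2) + 2 * (1 - tau) * dotv e (res w2)).
Proof.
move=> st1 st2; cbv zeta; set e := calB P *m _.
have [ts0 t1 t0 hxi] := regionK_bounds _ _ _ hK.
have cross := cross_term_bound _ _ _ hsigma2 st1 st2.
have hd : 0 <= normHy (yof w2 - yof w1) by exact: sqnorm_mx_block_ge0.
have sq := sqnorm_ge0 ((1 - tau) *: e + (1 - s) *: res w1).
have := sqnorm_ge0 (res w2).
move: cross hd sq; rewrite -/e; clearbody e.
move: (res w1) (res w2) (normHy _) (normHy _) => r1 r2 d2 d1.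
rewrite /sqnorm !dotvlin (dotvC r1 e) /xi3 /xi4.
move: (dotv e e) (dotv e r1) (dotv e r2) (dotv r1 r1) (dotv r2 r2).
move=> ee er1 er2 r11 r22 cross hd sq r22_ge0.
have ti : 0 < (1 + tau)^-1 by rewrite invr_gt0.
have tiE : (1 + tau)^-1 * (1 + tau) = 1 by rewrite mulVf// gt_eqF.
move: (1 + tau)^-1 => c in ti tiE hxi *.
have := ler_wpM2r r22_ge0 (ler_wpM2l (ltW hbeta) hxi).
have := mulr_ge0 (ltW (mulr_gt0 hbeta ti)) sq.
have t1' : 0 <= 1 - tau by rewrite subr_ge0.
(* This factor, [(1 - tau) / (1 + tau)], turns the coefficient [1 + tau] of the inner product into
   [1 - tau], half the one in the goal. *)
have := ler_wpM2l (mulr_ge0 t1' (ltW ti)) cross.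
(* The relation [c * (1 + tau) = 1] is multiplied in advance by the monomials where it is needed,
   leaving a linear problem. *)
have := congr1 ( *%R (beta * (1 - tau) * ee)) tiE.
have := congr1 ( *%R (beta * (1 - tau) * er2)) tiE.
by lra.
Qed.

Lemma ergodic_bound (wk : nat -> W) (t : nat) w :
  gsadmm P beta sigma1 sigma2 tau s wk -> (0 < t)%N -> calM P w ->
  hh P (u_avg wk t) - hh P (uof w) + dotv (w_avg P beta wk t - w) (calJ P w)
  <= (2 * t%:R)^-1 * (normH (w - wk 1%N) + xi3 * sqnorm (res (wk 1%N))
                      + xi4 * normHy (yof (wk 1%N) - yof (wk 0%N))).
Proof.
move=> [_ step] t_gt0 Mw.
have [ts0 t1 t0 hxi] := regionK_bounds _ _ _ hK.
have xi3_ge0 : 0 <= xi3 by rewrite mulr_ge0 ?(ltW hbeta)// divr_ge0 ?sqr_ge0 ?ltW.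
have xi4_ge0 : 0 <= xi4 by rewrite divr_ge0 ?subr_ge0// ltW.
(* The telescoping potential; the truncated [k.-1] matters only at [0], which the sum never
   reaches. *)
pose V k := normH (w - wk k) + xi3 * sqnorm (res (wk k))
  + xi4 * normHy (yof (wk k) - yof (wk k.-1)).
have V_ge0 k : 0 <= V k.
  apply: addr_ge0; last by rewrite mulr_ge0// sqnorm_mx_block_ge0.
  by rewrite addr_ge0 ?sqnorm_H_ge0// mulr_ge0// sqnorm_ge0.
pose gap k := hh P (u_tilde wk k) - hh P (uof w)
  + dotv (w_tilde P beta wk k - w) (calJ P w).
have gap_le k : (0 < k)%N -> gap k <= 2^-1 * (V k - V k.+1).
  (* The descent compares two consecutive steps, so the gap at [k.+1] needs the step from [k]; hence
     the start at index 1. *)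
  case: k => // k _.
  have h1 := one_step _ _ w hsigma1 ts0 (step k.+1) Mw.
  have h2 := residual_descent _ _ _ (step k) (step k.+1).
  rewrite /V /=; move: h1 h2; rewrite /= -/(u_tilde wk k.+1).
  rewrite -/(lam_tilde P beta wk k.+1) -/(w_tilde P beta wk k.+1) -/(gap k.+1).
  by lra.
have sum_gap : \sum_(1 <= k < t.+1) gap k <= 2^-1 * V 1%N.
  apply: (@le_trans _ _ (\sum_(1 <= k < t.+1) 2^-1 * (V k - V k.+1))).
    by rewrite big_nat [leRHS]big_nat; apply: ler_sum => k /andP[k0 _]; exact: gap_le.
  rewrite -mulr_sumr ler_pM2l ?invr_gt0//.
  rewrite (eq_bigr (fun k => - (V k.+1 - V k))); last by move=> k _; rewrite opprB.
  (* The final [V t.+1] is nonnegative and is dropped. *)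
  by rewrite sumrN telescope_sumr// opprB gerBl.
have T0 : 0 < t%:R :> R by rewrite ltr0n.
rewrite -/(V 1%N) invfM (mulrC 2^-1) -mulrA.
apply: le_trans (ler_wpM2l _ sum_gap); last by rewrite invr_ge0 ltW.
have hu : hh P (u_avg wk t) <= t%:R^-1 * \sum_(1 <= k < t.+1) hh P (u_tilde wk k).
  apply: convex_function_avg => //; apply: hh_convex => i.
  - by case: (ff_closed_convex hP i).
  - by case: (gg_closed_convex hP i).
(* [calJ] is evaluated at the fixed [w], so the inner product averages exactly; only [hh] needs
   Jensen. *)
rewrite /gap big_split/= sumrB sumr_const_nat subSS subn0.
rewrite -dotv_suml sumrB sumr_const_nat subSS subn0 -[hh P (uof w) *+ t]mulr_natl.
rewrite mulrDr mulrBr mulKf ?gt_eqF// -dotvZl scalerBr -/(w_avg P beta wk t).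
rewrite -[w *+ t]scaler_nat scalerA mulVf ?gt_eqF// scale1r.
by rewrite lerD2r lerD2r.
Qed.

End Convergence.

Theorem theorem7 (R : realType) (p q n : nat) (m : 'I_p -> nat) (d : 'I_q -> nat)
    (P : problem R n m d) (hp : (1 <= p)%N) (hq : (1 <= q)%N)
    (hP : standing_assumptions P)
    (beta sigma1 sigma2 tau s : R)
    (hbeta : 0 < beta) (hsigma1 : p%:R - 1 < sigma1) (hsigma2 : q%:R - 1 < sigma2)
    (hK : regionK (tau, s)) :
  exists xi3 xi4 : R, [/\ 0 <= xi3, 0 <= xi4 &
    forall wk : nat -> 'cV[R]_(\sum_i m i + (\sum_j d j + n)),
      gsadmm P beta sigma1 sigma2 tau s wk ->
    forall t : nat, (1 <= t)%N ->
    forall w : 'cV[R]_(\sum_i m i + (\sum_j d j + n)), calM P w ->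
      hh P (u_avg wk t) - hh P (uof w) + dotv (w_avg P beta wk t - w) (calJ P w)
      <= (2 * t%:R)^-1 *
         (sqnorm_mx (H_mx P beta sigma1 sigma2 tau s) (w - wk 1%N)
          + xi3 * sqnorm (resid P (xof (wk 1%N)) (yof (wk 1%N)))
          + xi4 * sqnorm_mx (H_y P beta sigma2) (yof (wk 1%N) - yof (wk 0%N)))].
Proof.
have [ts0 t1 t0 _] := regionK_bounds _ _ _ hK.
(* Both constants depend on the parameters alone, so they serve every sequence. *)
exists (beta * ((1 - s) ^+ 2 / (1 + tau))), ((1 - tau) / (1 + tau)); split.
- by rewrite mulr_ge0 ?(ltW hbeta)// divr_ge0 ?sqr_ge0 ?ltW.
- by rewrite divr_ge0 ?subr_ge0// ltW.
by move=> wk hwk t t_gt0 w Mw; exact: ergodic_bound.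
Qed.
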